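(* Let $\Lambda=KQ_\Lambda/I_\Lambda$ be a finite-dimensional algebra over a field $K$ and let $T(\Lambda)=KQ_{T(\Lambda)}/I_{T(\Lambda)}$ be its trivial extension algebra. If there exists a super-decomposable $\Lambda$-module, then there exists a super-decomposable $T(\Lambda)$-module.
   Context: $KQ_\Lambda/I_\Lambda$ denotes a presentation of $\Lambda$ by a quiver with relations (and similarly for $T(\Lambda)$). The trivial extension algebra is $T(\Lambda)=\Lambda\ltimes D(\Lambda)$ with $D(\Lambda)=\mathrm{Hom}_K(\Lambda,K)$: the vector space $\Lambda\oplus D(\Lambda)$ with multiplication $(\lambda_1,f)(\lambda_2,g)=(\lambda_1\lambda_2,\lambda_1g+f\lambda_2)$. A module (not necessarily finite-dimensional) is super-decomposable if it is nonzero and has no indecomposable direct summands. *)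

(* Defs.v *)
From HB Require Import structures.
From mathcomp Require Import all_boot all_order all_algebra all_field finmap.
From mathcomp Require Import monalg.

Set Implicit Arguments.
Unset Strict Implicit.
Unset Printing Implicit Defensive.

Import GRing.Theory.
Local Open Scope ring_scope.

(* A nonempty vertex set makes the path algebra a nonzero ring. *)
Record quiver := Quiver {
  vertex : finType;
  arrow : finType;
  source : arrow -> vertex;
  target : arrow -> vertex;
  vertex_gt0 : (0 < #|vertex|)%N
}.

Section Paths.
Variable Q : quiver.
Implicit Types (x y : vertex Q) (a : arrow Q) (s t : seq (arrow Q)).

Fixpoint is_walk x s : bool :=
  if s is a :: s' then (source a == x) && is_walk (target a) s' else true.

Definition walk_end x s : vertex Q := last x [seq target a | a <- s].

Lemma walk_end_cat x s t : walk_end x (s ++ t) = walk_end (walk_end x s) t.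
Proof. by rewrite /walk_end map_cat last_cat. Qed.

Lemma is_walk_cat x s t :
  is_walk x (s ++ t) = is_walk x s && is_walk (walk_end x s) t.
Proof.
elim: s x => [|a s IHs] x //=.
by rewrite IHs andbA.
Qed.

(* The initial vertex is recorded because it tells apart the trivial paths    *)
(* e_x = (x, [::]).                                                           *)
Record qpath := QPath {
  qpath_val : vertex Q * seq (arrow Q);
  _ : is_walk qpath_val.1 qpath_val.2
}.
HB.instance Definition _ := [isSub for qpath_val].
HB.instance Definition _ := [Choice of qpath by <:].

Implicit Types p q r : qpath.

Definition psource p : vertex Q := (val p).1.
Definition parrows p : seq (arrow Q) := (val p).2.
Definition ptarget p : vertex Q := walk_end (psource p) (parrows p).

Definition trivial_path x : qpath := @QPath (x, [::]) isT.

(* Composable paths are concatenated from left to right: p, then q. *)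
Definition pcat p q : option qpath :=
  if ptarget p == psource q
  then insub (psource p, parrows p ++ parrows q) else None.

Variant pcat_spec p q : option qpath -> Type :=
| PCatSome r of ptarget p = psource q & psource r = psource p
    & parrows r = parrows p ++ parrows q & ptarget r = ptarget q :
    pcat_spec p q (Some r)
| PCatNone of ptarget p != psource q : pcat_spec p q None.

Lemma pcatP p q : pcat_spec p q (pcat p q).
Proof.
rewrite /pcat; case: eqP => [e|/eqP]; last by right.
have w : is_walk (psource p) (parrows p ++ parrows q).
  by rewrite is_walk_cat (valP p) -/(ptarget p) e (valP q).
have w' : is_walk (psource p, parrows p ++ parrows q).1
    (psource p, parrows p ++ parrows q).2 by [].
rewrite (insubT (fun w => is_walk w.1 w.2) w'); left => //=.
by rewrite /ptarget /psource /parrows /= walk_end_cat -/(ptarget p) e.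
Qed.

Lemma qpath_eq p q : psource p = psource q -> parrows p = parrows q -> p = q.
Proof.
move=> e1 e2; apply: val_inj; move: e1 e2; rewrite /psource /parrows.
by case: (val p) (val q) => [? ?] [? ?] /= -> ->.
Qed.

Lemma pcatA p q r : obind (pcat p) (pcat q r) = obind (pcat^~ r) (pcat p q).
Proof.
case: (pcatP q r) => [u e1 e2 e3 e4|n1]; case: (pcatP p q) => [v f1 f2 f3 f4|m1] //=.
- case: pcatP => [w g1 g2 g3 g4|]; last by rewrite e2 f1 eqxx.
  case: pcatP => [z h1 h2 h3 h4|]; last by rewrite f4 e1 eqxx.
  by congr Some; apply: qpath_eq; rewrite ?g2 ?h2 ?f2 // g3 h3 e3 f3 catA.
- by case: pcatP => // w; rewrite e2 => g1; rewrite g1 eqxx in m1.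
- by case: pcatP => // w; rewrite f4 => g1; rewrite g1 eqxx in n1.
Qed.

Lemma trivial_pathK : cancel trivial_path psource.
Proof. by []. Qed.

Lemma pcat1p x p :
  pcat (trivial_path x) p = if x == psource p then Some p else None.
Proof.
case: pcatP => [r e1 e2 e3 _|/negPf] /=; last by rewrite /ptarget /= => ->.
rewrite -e1 /ptarget eqxx; congr Some; apply: qpath_eq => //.
by rewrite e2 -e1.
Qed.

Lemma pcatp1 p x :
  pcat p (trivial_path x) = if ptarget p == x then Some p else None.
Proof.
case: pcatP => [r e1 e2 e3 _|/negPf] /=; last by move=> ->.
rewrite e1 eqxx; congr Some; apply: qpath_eq => //.
by rewrite e3 cats0.
Qed.

End Paths.

(* The multiplication below is set up for an arbitrary partial composition    *)
(* [comp] on a choiceType of morphisms, and then specialized to paths.        *)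
Section CategoryAlgebra.
Variables (K : fieldType) (V : finType) (T : choiceType).
Variables (src tgt : T -> V) (idm : V -> T) (comp : T -> T -> option T).

Local Notation alg := {malg K[T]}.
Implicit Types (f g h : alg) (p q r : T).

Definition catalg_comp p q : alg :=
  if comp p q is Some r then << r >> else 0.

Definition catalg_mul f g : alg :=
  \sum_(p <- msupp f) \sum_(q <- msupp g) (f@_p * g@_q) *: catalg_comp p q.

Definition catalg_one : alg :=
  \sum_(x : V) << idm x >>.

Local Notation "f ** g" := (catalg_mul f g) (at level 40).

Lemma catalg_mulEw (d1 d2 : {fset T}) f g :
  (msupp f `<=` d1)%fset -> (msupp g `<=` d2)%fset ->
  f ** g = \sum_(p <- d1) \sum_(q <- d2) (f@_p * g@_q) *: catalg_comp p q.
Proof.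
move=> le1 le2; rewrite /catalg_mul (big_fset_incl _ le1) /=.
  apply/eq_bigr=> p _; apply/big_fset_incl => // q _ /mcoeff_outdom ->.
  by rewrite mulr0 scale0r.
move=> p _ /mcoeff_outdom fp.
by rewrite big1 => // q _; rewrite fp mul0r scale0r.
Qed.

Lemma catalg_mulDl : left_distributive catalg_mul +%R.
Proof.
move=> f g h; pose d := (msupp f `|` msupp g `|` msupp (f + g))%fset.
have s1 : (msupp f `<=` d)%fset by rewrite /d -fsetUA fsubsetUl.
have s2 : (msupp g `<=` d)%fset
  by rewrite /d fsetUAC fsubsetUr.
have s3 : (msupp (f + g) `<=` d)%fset by rewrite /d fsubsetUr.
rewrite (catalg_mulEw s1 (fsubset_refl _)).
rewrite (catalg_mulEw s2 (fsubset_refl _)).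
rewrite (catalg_mulEw s3 (fsubset_refl _)).
rewrite -big_split /=; apply: eq_bigr => p _.
rewrite -big_split /=; apply: eq_bigr => q _.
by rewrite mcoeffD mulrDl scalerDl.
Qed.

Lemma catalg_mulDr : right_distributive catalg_mul +%R.
Proof.
move=> f g h; pose d := (msupp g `|` msupp h `|` msupp (g + h))%fset.
have s1 : (msupp g `<=` d)%fset by rewrite /d -fsetUA fsubsetUl.
have s2 : (msupp h `<=` d)%fset
  by rewrite /d fsetUAC fsubsetUr.
have s3 : (msupp (g + h) `<=` d)%fset by rewrite /d fsubsetUr.
rewrite (catalg_mulEw (fsubset_refl _) s1).
rewrite (catalg_mulEw (fsubset_refl _) s2).
rewrite (catalg_mulEw (fsubset_refl _) s3).
rewrite -big_split /=; apply: eq_bigr => p _.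
rewrite -big_split /=; apply: eq_bigr => q _.
by rewrite mcoeffD mulrDr scalerDl.
Qed.

Lemma catalg_scaleAl c f g : c *: (f ** g) = (c *: f) ** g.
Proof.
rewrite (catalg_mulEw (msuppZ_le c f) (fsubset_refl _)) scaler_sumr.
apply: eq_bigr => p _; rewrite scaler_sumr; apply: eq_bigr => q _.
by rewrite scalerA mcoeffZ mulrA.
Qed.

Lemma catalg_scaleAr c f g : c *: (f ** g) = f ** (c *: g).
Proof.
rewrite (catalg_mulEw (fsubset_refl _) (msuppZ_le c g)) scaler_sumr.
apply: eq_bigr => p _; rewrite scaler_sumr; apply: eq_bigr => q _.
by rewrite scalerA mcoeffZ mulrCA.
Qed.

Lemma catalg_mul0l g : 0 ** g = 0.
Proof. by rewrite /catalg_mul msupp0 big_seq_fset0. Qed.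

Lemma catalg_mul0r f : f ** 0 = 0.
Proof.
by rewrite /catalg_mul big1 // => p _; rewrite msupp0 big_seq_fset0.
Qed.

Lemma catalg_mulUU p q : << p >> ** << q >> = catalg_comp p q.
Proof.
rewrite (catalg_mulEw msuppU_le msuppU_le).
by rewrite !big_seq_fset1 !mcoeffUU mulr1 scale1r.
Qed.

Lemma monalgU_scale c p : << c *g p >> = c *: << p >> :> alg.
Proof. by apply/malgP => q; rewrite mcoeffZ !mcoeffU mulrnAr mulr1. Qed.

Lemma catalgE f : f = \sum_(p <- msupp f) f@_p *: (<< p >> : alg).
Proof.
rewrite [LHS]monalgE; apply: eq_bigr => p _.
exact: monalgU_scale.
Qed.

Lemma catalg_ind (P : alg -> Prop) :
    P 0 -> (forall f g, P f -> P g -> P (f + g)) ->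
    (forall c f, P f -> P (c *: f)) -> (forall p, P << p >>) ->
  forall f, P f.
Proof.
move=> P0 PD PZ PU f; rewrite [f]catalgE.
by apply: (big_ind P) => // p _; apply: PZ.
Qed.

Hypothesis compA :
  forall p q r, obind (comp p) (comp q r) = obind (comp^~ r) (comp p q).
Hypothesis comp1p :
  forall x p, comp (idm x) p = if x == src p then Some p else None.
Hypothesis compp1 :
  forall p x, comp p (idm x) = if tgt p == x then Some p else None.
Hypothesis src_idm : cancel idm src.
Hypothesis V_gt0 : (0 < #|V|)%N.

Lemma catalg_mulA : associative catalg_mul.
Proof.
move=> f g h; elim/catalg_ind: f => [|f1 f2 e1 e2|c f e|p].
- by rewrite !catalg_mul0l.
- by rewrite !catalg_mulDl e1 e2.
- by rewrite -!catalg_scaleAl e.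
elim/catalg_ind: g => [|f1 f2 e1 e2|c f e|q].
- by rewrite catalg_mul0r !catalg_mul0l catalg_mul0r.
- by rewrite catalg_mulDr !catalg_mulDl catalg_mulDr e1 e2.
- by rewrite -catalg_scaleAr -!catalg_scaleAl -catalg_scaleAr e.
elim/catalg_ind: h => [|f1 f2 e1 e2|c f e|r].
- by rewrite !catalg_mul0r.
- by rewrite !catalg_mulDr e1 e2.
- by rewrite -!catalg_scaleAr e.
rewrite !catalg_mulUU {1 2}/catalg_comp.
have := compA p q r; case: (comp q r) => [u|]; case: (comp p q) => [v|] /= e.
- by rewrite !catalg_mulUU /catalg_comp e.
- by rewrite catalg_mulUU catalg_mul0l /catalg_comp e.
- by rewrite catalg_mulUU catalg_mul0r /catalg_comp -e.
- by rewrite catalg_mul0l catalg_mul0r.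
Qed.

Lemma catalg_mul1l : left_id catalg_one catalg_mul.
Proof.
elim/catalg_ind => [|f g ef eg|c f e|p].
- by rewrite catalg_mul0r.
- by rewrite catalg_mulDr ef eg.
- by rewrite -catalg_scaleAr e.
have -> : catalg_one ** << p >> = \sum_x (<< idm x >> ** << p >>).
  apply: (big_morph (catalg_mul^~ << p >>)) => [f g|].
    exact: catalg_mulDl.
  exact: catalg_mul0l.
rewrite (bigD1 (src p)) //= catalg_mulUU /catalg_comp comp1p eqxx.
rewrite big1 ?addr0 // => x /negPf ne.
by rewrite catalg_mulUU /catalg_comp comp1p ne.
Qed.

Lemma catalg_mul1r : right_id catalg_one catalg_mul.
Proof.
elim/catalg_ind => [|f g ef eg|c f e|p].
- by rewrite catalg_mul0l.
- by rewrite catalg_mulDl ef eg.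
- by rewrite -catalg_scaleAl e.
have -> : << p >> ** catalg_one = \sum_x (<< p >> ** << idm x >>).
  apply: (big_morph (catalg_mul << p >>)) => [f g|].
    exact: catalg_mulDr.
  exact: catalg_mul0r.
rewrite (bigD1 (tgt p)) //= catalg_mulUU /catalg_comp compp1 eqxx.
rewrite big1 ?addr0 // => x; rewrite eq_sym => /negPf ne.
by rewrite catalg_mulUU /catalg_comp compp1 ne.
Qed.

Lemma catalg_oner_neq0 : catalg_one != 0.
Proof.
have /card_gt0P[x _] := V_gt0.
apply/eqP => /(congr1 (mcoeff (idm x))) /eqP.
rewrite raddf_sum mcoeff0 (bigD1 x) //= mcoeffUU big1 ?addr0 ?oner_eq0 //.
by move=> y ne; rewrite mcoeffU (can_eq src_idm) (negPf ne).
Qed.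

End CategoryAlgebra.

Section PathAlgebra.
Variables (K : fieldType) (Q : quiver).

Definition path_algebra : Type := {malg K[qpath Q]}.
HB.instance Definition _ := GRing.Lmodule.on path_algebra.

Implicit Types (f g : path_algebra) (p : qpath Q).

Definition path_algebra_mul : path_algebra -> path_algebra -> path_algebra :=
  catalg_mul (@pcat Q).

Definition path_algebra_one : path_algebra := catalg_one K (@trivial_path Q).

HB.instance Definition _ :=
  GRing.Zmodule_isNzRing.Build path_algebra
    (catalg_mulA (@pcatA Q))
    (catalg_mul1l (@pcat1p Q) : left_id path_algebra_one path_algebra_mul)
    (catalg_mul1r (@pcatp1 Q))
    (@catalg_mulDl K _ (@pcat Q)) (@catalg_mulDr K _ (@pcat Q))
    (catalg_oner_neq0 K (trivial_pathK (Q := Q)) (vertex_gt0 Q)).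
HB.instance Definition _ := GRing.Lmodule_isLalgebra.Build K path_algebra
  (@catalg_scaleAl K _ (@pcat Q)).
HB.instance Definition _ := GRing.Lalgebra_isAlgebra.Build K path_algebra
  (@catalg_scaleAr K _ (@pcat Q)).

(* A linear combination of parallel paths. Neither a lower bound on the path  *)
(* lengths nor admissibility of the generated ideal is imposed.               *)
Definition is_relation f : Prop :=
  exists x y : vertex Q,
    forall p, p \in msupp f -> psource p = x /\ ptarget p = y.

Definition two_sided_ideal (I : path_algebra -> Prop) : Prop :=
  [/\ I 0, forall f g, I f -> I g -> I (f + g),
      forall f g, I g -> I (f * g) & forall f g, I f -> I (f * g)].

Definition ideal_gen (S : path_algebra -> Prop) (f : path_algebra) : Prop :=
  forall I, two_sided_ideal I -> (forall g, S g -> I g) -> I f.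

Definition ideal_of_relations (I : path_algebra -> Prop) : Prop :=
  exists S : path_algebra -> Prop,
    (forall f, S f -> is_relation f) /\ (forall f, I f <-> ideal_gen S f).

(* An isomorphism KQ/I -> A, given as a surjection KQ -> A with kernel I. *)
Definition presented_by (A : algType K) (I : path_algebra -> Prop) : Prop :=
  exists phi : {lrmorphism path_algebra -> A},
    (forall a, exists f, phi f = a) /\ (forall f, phi f = 0 <-> I f).

End PathAlgebra.

Section TrivialExtension.
Variables (K : fieldType) (A : falgType K).

Definition dual : Type := 'Hom(A, K^o).
HB.instance Definition _ := Vector.on dual.

(* The bimodule actions on the dual: (a f)(x) = f(xa) and (f a)(x) = f(ax). *)
Definition dual_lact (a : A) (f : dual) : dual := (f \o amulr a)%VF.
Definition dual_ract (f : dual) (a : A) : dual := (f \o amull a)%VF.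

Definition trivial_extension : Type := (A * dual)%type.
HB.instance Definition _ := Vector.on trivial_extension.

Implicit Types u v w : trivial_extension.

Definition triv_ext_one : trivial_extension := (1, 0).
Definition triv_ext_mul u v : trivial_extension :=
  (u.1 * v.1, dual_lact u.1 v.2 + dual_ract u.2 v.1).

Lemma dual_lactE a f x : dual_lact a f x = f (x * a).
Proof. by rewrite /dual_lact comp_lfunE lfunE. Qed.

Lemma dual_ractE a f x : dual_ract f a x = f (a * x).
Proof. by rewrite /dual_ract comp_lfunE lfunE. Qed.

Lemma dual_addE (f g : dual) x : (f + g : dual) x = f x + g x.
Proof. exact: add_lfunE. Qed.

Lemma dual_scaleE c (f : dual) x : (c *: f : dual) x = c * f x.
Proof. exact: scale_lfunE. Qed.

Lemma dual0E x : (0 : dual) x = 0.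
Proof. exact: zero_lfunE. Qed.

Definition dualE := (dual_addE, dual_lactE, dual_ractE, dual_scaleE, dual0E).

Lemma triv_ext_eq u v : u.1 = v.1 -> (forall x, u.2 x = v.2 x) -> u = v.
Proof. by case: u v => [a f] [b g] /= -> /lfunP ->. Qed.

Lemma triv_ext_mulA : associative triv_ext_mul.
Proof.
move=> u v w; apply: triv_ext_eq => /= [|x]; first exact: mulrA.
by rewrite !dualE addrA !mulrA.
Qed.

Lemma triv_ext_mul1l : left_id triv_ext_one triv_ext_mul.
Proof.
move=> u; apply: triv_ext_eq => /= [|x]; first exact: mul1r.
by rewrite !dualE mulr1 addr0.
Qed.

Lemma triv_ext_mul1r : right_id triv_ext_one triv_ext_mul.
Proof.
move=> u; apply: triv_ext_eq => /= [|x]; first exact: mulr1.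
by rewrite !dualE mul1r add0r.
Qed.

Lemma triv_ext_mulDl : left_distributive triv_ext_mul +%R.
Proof.
move=> u v w; apply: triv_ext_eq => /= [|x]; first exact: mulrDl.
by rewrite !dualE mulrDr linearD /= addrACA.
Qed.

Lemma triv_ext_mulDr : right_distributive triv_ext_mul +%R.
Proof.
move=> u v w; apply: triv_ext_eq => /= [|x]; first exact: mulrDr.
by rewrite !dualE mulrDl linearD /= addrACA.
Qed.

Lemma triv_ext_oner_neq0 : triv_ext_one != 0.
Proof. by apply/eqP => -[/eqP]; rewrite oner_eq0. Qed.

HB.instance Definition _ := GRing.Zmodule_isNzRing.Build trivial_extension
  triv_ext_mulA triv_ext_mul1l triv_ext_mul1r
  triv_ext_mulDl triv_ext_mulDr triv_ext_oner_neq0.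

Lemma triv_ext_scaleAl c u v : c *: (u * v) = (c *: u) * v.
Proof.
apply: triv_ext_eq => /= [|x]; first exact: scalerAl.
by rewrite !dualE -scalerAr linearZ /= mulrDr.
Qed.

HB.instance Definition _ :=
  GRing.Lmodule_isLalgebra.Build K trivial_extension triv_ext_scaleAl.

Lemma triv_ext_scaleAr c u v : c *: (u * v) = u * (c *: v).
Proof.
apply: triv_ext_eq => /= [|x]; first exact: scalerAr.
by rewrite !dualE -scalerAl linearZ /= mulrDr.
Qed.

HB.instance Definition _ :=
  GRing.Lalgebra_isAlgebra.Build K trivial_extension triv_ext_scaleAr.
HB.instance Definition _ := Algebra_isFalgebra.Build K trivial_extension.

End TrivialExtension.

Section Modules.
Variable R : nzRingType.
Implicit Types M N : lmodType R.

Definition zero_module M : Prop := forall x : M, x = 0.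

(* N is a direct summand of M up to isomorphism: M ~ N (+) N'. *)
Definition direct_summand N M : Prop :=
  exists (N' : lmodType R) (f : {linear (N * N')%type -> M}), bijective f.

Definition indecomposable M : Prop :=
  ~ zero_module M /\
  forall (N N' : lmodType R) (f : {linear (N * N')%type -> M}),
    bijective f -> zero_module N \/ zero_module N'.

Definition super_decomposable M : Prop :=
  ~ zero_module M /\ forall N, direct_summand N M -> ~ indecomposable N.

End Modules.

(* Main.v *)
Require Import Defs.
From mathcomp Require Import all_boot all_algebra all_field.
From HB Require Import structures.

(** A Lambda-module M is inflated to a T(Lambda)-module along the projection
    T(Lambda) -> Lambda, which annihilates the ideal D(Lambda).  Direct summands
    of the inflation are submodules of it, so they are annihilated by D(Lambda)
    too: they are again inflations.  Hence M and its inflation have the same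
    direct sum decompositions, and in particular one has an indecomposable
    summand if and only if the other has.

    The projection has the ring section a |-> (a, 0), so the Lambda-module whose
    inflation is a given summand is obtained by restriction along that section
    ([summand_inflation_restriction] and [summand_inflation_indecomposable]);
    the argument is carried out for an arbitrary split ring morphism in
    [super_decomposable_inflation]. *)

Set Implicit Arguments.
Unset Strict Implicit.
Unset Printing Implicit Defensive.

Import GRing.Theory.
Local Open Scope ring_scope.

(** The morphism [h] is an argument of this alias of [N], so that the type
    determines the scalar action. *)
Definition restrict_scalars (R S : nzRingType) (h : {rmorphism R -> S})
  (N : lmodType S) : Type := N.

Section RestrictionOfScalars.
Variables (R S : nzRingType) (h : {rmorphism R -> S}) (N : lmodType S).

Local Notation hN := (restrict_scalars h N).

HB.instance Definition _ := GRing.Zmodule.copy hN N.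

Definition restrict_scale (a : R) (x : hN) : hN := h a *: (x : N).

Fact restrict_scaleA a b x :
  restrict_scale a (restrict_scale b x) = restrict_scale (a * b) x.
Proof. by rewrite /restrict_scale scalerA rmorphM. Qed.

Fact restrict_scale1 : left_id 1 restrict_scale.
Proof. by move=> x; rewrite /restrict_scale rmorph1 scale1r. Qed.

Fact restrict_scaleDr : right_distributive restrict_scale +%R.
Proof. by move=> a x y; rewrite /restrict_scale; apply: scalerDr. Qed.

Fact restrict_scaleDl x : {morph restrict_scale^~ x : a b / a + b}.
Proof. by move=> a b; rewrite /restrict_scale rmorphD; apply: scalerDl. Qed.

HB.instance Definition _ := GRing.Zmodule_isLmodule.Build R hN
  restrict_scaleA restrict_scale1 restrict_scaleDr restrict_scaleDl.

End RestrictionOfScalars.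

(** Restriction of scalars does not change the underlying group, so a
    decomposition over one ring is a decomposition over another one as soon as
    the underlying map is linear over both. *)
Lemma bijective_linear_pack (R : nzRingType) (U V : lmodType R) (f : U -> V) :
  linear f -> bijective f -> exists g : {linear U -> V}, bijective g.
Proof.
move=> lf bf.
pose fL := GRing.isLinear.Build R U V *:%R f lf.
pose g : {linear U -> V} := HB.pack f fL.
by exists g.
Qed.

Section InflationAlongSplitMorphism.
Variables (R S : nzRingType).
Variables (pi : {rmorphism S -> R}) (iota : {rmorphism R -> S}).
Hypothesis iotaK : cancel iota pi.

Local Notation inflation := (restrict_scalars pi).
Local Notation restriction := (restrict_scalars iota).

Variables (M : lmodType R) (N N' : lmodType S).
Variable f : {linear (N * N')%type -> inflation M}.
Hypothesis f_bij : bijective f.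

(** The kernel of [pi] annihilates the inflation of [M], hence also [N], which
    embeds into it. *)
Lemma summand_inflation_scale s (y : N) : s *: y = iota (pi s) *: y.
Proof.
have f_scale t : f (t *: y, 0) = t *: f (y, 0).
  by rewrite -linearZ; congr (f (_, _)); rewrite /= scaler0.
have /(bij_inj f_bij)[] // : f (s *: y, 0) = f (iota (pi s) *: y, 0).
by rewrite !f_scale; congr (_ *: _ : M); rewrite iotaK.
Qed.

(** Restricting a decomposition of the inflation along [iota] gives a
    decomposition of [M] itself, because [pi \o iota] is the identity. *)
Lemma summand_inflation_restriction :
  direct_summand (restriction N : lmodType R) M.
Proof.
have lf : linear (f : (restriction N * restriction N')%type -> M).
  move=> a u v.
  have -> : f (a *: u + v) = f (iota a *: (u : (N * N')%type) + v) by [].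
  by rewrite linearP; congr (_ *: _ + _ : M); rewrite iotaK.
by have [g g_bij] := bijective_linear_pack lf f_bij; exists (restriction N'), g.
Qed.

(** By [summand_inflation_scale], inflating a decomposition of the restriction
    of [N] gives a decomposition of [N]. *)
Lemma summand_inflation_indecomposable :
  indecomposable N -> indecomposable (restriction N : lmodType R).
Proof.
move=> [N_neq0 N_indec]; split=> // L L' g g_bij.
have lg : linear (g : (inflation L * inflation L')%type -> N).
  move=> s u v.
  have -> : g (s *: u + v) = g (pi s *: (u : (L * L')%type) + v) by [].
  by rewrite linearP summand_inflation_scale.
have [g' g'_bij] := bijective_linear_pack lg g_bij.
exact: N_indec g'_bij.
Qed.

End InflationAlongSplitMorphism.

Lemma super_decomposable_inflation (R S : nzRingType)
    (pi : {rmorphism S -> R}) (iota : {rmorphism R -> S}) (M : lmodType R) :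
  cancel iota pi -> super_decomposable M ->
  super_decomposable (restrict_scalars pi M : lmodType S).
Proof.
move=> iotaK [M_neq0 M_super]; split=> // N [N' [f f_bij]] N_indec.
apply: M_super (summand_inflation_restriction iotaK f_bij) _.
exact (summand_inflation_indecomposable iotaK f_bij N_indec).
Qed.

Section TrivialExtensionMorphisms.
Variables (K : fieldType) (A : falgType K).

Definition triv_ext_proj (u : trivial_extension A) : A := u.1.
Definition triv_ext_incl (a : A) : trivial_extension A := (a, 0).

Fact triv_ext_proj_zmod : zmod_morphism triv_ext_proj.
Proof. by []. Qed.

Fact triv_ext_proj_monoid : monoid_morphism triv_ext_proj.
Proof. by []. Qed.

HB.instance Definition _ := GRing.isZmodMorphism.Build
  (trivial_extension A) A triv_ext_proj triv_ext_proj_zmod.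
HB.instance Definition _ := GRing.isMonoidMorphism.Build
  (trivial_extension A) A triv_ext_proj triv_ext_proj_monoid.

Fact triv_ext_incl_zmod : zmod_morphism triv_ext_incl.
Proof. by move=> a b; congr (_, _); rewrite /= subr0. Qed.

Fact triv_ext_incl_monoid : monoid_morphism triv_ext_incl.
Proof.
by split=> // a b; apply: triv_ext_eq => //= x; rewrite !dualE addr0.
Qed.

HB.instance Definition _ := GRing.isZmodMorphism.Build
  A (trivial_extension A) triv_ext_incl triv_ext_incl_zmod.
HB.instance Definition _ := GRing.isMonoidMorphism.Build
  A (trivial_extension A) triv_ext_incl triv_ext_incl_monoid.

Lemma triv_ext_inclK : cancel triv_ext_incl triv_ext_proj.
Proof. by []. Qed.

End TrivialExtensionMorphisms.

Theorem theorem1p5 (K : fieldType)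
    (Lambda : falgType K)
    (Q : quiver) (I : path_algebra K Q -> Prop)
    (hI : ideal_of_relations I) (hLambda : presented_by Lambda I)
    (QT : quiver) (IT : path_algebra K QT -> Prop)
    (hIT : ideal_of_relations IT)
    (hT : presented_by (trivial_extension Lambda) IT) :
  (exists M : lmodType Lambda, super_decomposable M) ->
  exists N : lmodType (trivial_extension Lambda), super_decomposable N.
Proof.
case=> M M_super; exists (restrict_scalars (@triv_ext_proj K Lambda) M).
exact: super_decomposable_inflation (@triv_ext_inclK K Lambda) M_super.
Qed.
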